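(* For every integer $k\geq 2$ there exists a $k$-step nilpotent Anosov Lie algebra $\mathfrak{n}$ with $\dim\mathfrak{n}=2k+2$.
   Context: A rational Lie algebra is a finite-dimensional Lie algebra over $\mathbb{Q}$. A rational Lie algebra $\mathfrak{n}$ of dimension $d$ is called Anosov if there exist a Lie algebra automorphism $A$ of $\mathfrak{n}$ and a basis $\beta$ of $\mathfrak{n}$ over $\mathbb{Q}$ such that $A$ is hyperbolic, i.e. all (complex) eigenvalues of $A$ have absolute value different from $1$, and the matrix $[A]_\beta$ of $A$ with respect to $\beta$ lies in $\mathrm{GL}(d,\mathbb{Z})$. A Lie algebra is $k$-step nilpotent if its lower central series $C^0=\mathfrak{n}$, $C^{i+1}=[\mathfrak{n},C^i]$ satisfies $C^k=0$ and $C^{k-1}\neq 0$. *)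

(* Defs.v *)
From HB Require Import structures.
From mathcomp Require Import all_boot all_order all_algebra.
From mathcomp Require Import reals Rstruct complex.

Set Implicit Arguments.
Unset Strict Implicit.
Unset Printing Implicit Defensive.

Import GRing.Theory Num.Theory passmx.

Local Open Scope ring_scope.

(* Finite-dimensional Lie algebras: [vectType] already includes finite
   dimension.  The alternating law is stated as [x, x] = 0. *)
HB.mixin Record Vector_isLie (F : fieldType) V of Vector F V := {
  lie_bracket : V -> V -> V;
  lie_bracket_linear_l : forall y : V, linear (lie_bracket ^~ y);
  lie_bracket_linear_r : forall x : V, linear (lie_bracket x);
  lie_bracketxx : forall x : V, lie_bracket x x = 0;
  lie_jacobi : forall x y z : V,
    lie_bracket x (lie_bracket y z) + lie_bracket y (lie_bracket z x)
      + lie_bracket z (lie_bracket x y) = 0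
}.

#[short(type="lieAlgType")]
HB.structure Definition LieAlgebra (F : fieldType) :=
  {V of Vector_isLie F V & Vector F V}.

Section LieAlgebraTheory.
Variables (F : fieldType) (L : lieAlgType F).
Implicit Types (U V W : {vspace L}) (x y : L).

HB.instance Definition _ x := GRing.isSemilinear.Build F L L _ (lie_bracket x)
  (GRing.semilinear_linear (lie_bracket_linear_r x)).

Definition lie_bracketr y x : L := lie_bracket x y.

HB.instance Definition _ y := GRing.isSemilinear.Build F L L _ (lie_bracketr y)
  (GRing.semilinear_linear (lie_bracket_linear_l y)).

(* The span of all brackets of an element of U with an element of V; restricting
   to bases loses nothing by bilinearity (see [memv_lie] and [lie_spanP]). *)
Definition lie_span U V : {vspace L} :=
  <<[seq lie_bracket u v | u <- vbasis U, v <- vbasis V]>>%VS.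

Lemma memv_lie U V :
  {in U & V, forall u v, lie_bracket u v \in lie_span U V}.
Proof.
move=> u v /coord_vbasis-> /coord_vbasis->.
rewrite -[lie_bracket _ _]/(lie_bracketr _ _) linear_sum.
apply: memv_suml => i _; rewrite linearZ /= /lie_bracketr linear_sum.
apply/memvZ/memv_suml => j _; rewrite linearZ /=; apply/memvZ/memv_span.
by apply/allpairsP; exists ((vbasis U)`_i, (vbasis V)`_j); rewrite !memt_nth.
Qed.

Lemma lie_spanP U V W :
  reflect {in U & V, forall u v, lie_bracket u v \in W} (lie_span U V <= W)%VS.
Proof.
apply: (iffP idP) => [sUVW u v Uu Vv | sUVW].
  by rewrite (subvP sUVW) ?memv_lie.
apply/span_subvP=> _ /allpairsP[[u v] /= [Uu Vv ->]].
by rewrite sUVW ?vbasis_mem.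
Qed.

Fixpoint lower_central (i : nat) : {vspace L} :=
  if i is j.+1 then lie_span fullv (lower_central j) else fullv.

(* For k = 0 the two conditions contradict each other. *)
Definition step_nilpotent (k : nat) : Prop :=
  lower_central k = 0%VS /\ lower_central k.-1 <> 0%VS.

Definition lie_automorphism (A : 'End(L)) : Prop :=
  bijective A /\ {morph A : x y / lie_bracket x y}.

End LieAlgebraTheory.

(* Row-vector convention: v *m mxof b b A is the coordinate vector of A v, so
   the row eigenvectors of this matrix over the complex numbers are the
   eigenvectors of the complexification of A.  The basis is immaterial, see
   [complex_eigenvalue_basis]. *)
Definition complex_eigenvalue (V : vectType rat) (A : 'End(V)) :
    pred (Rdefinitions.R)[i] :=
  eigenvalue (map_mx ratr (mxof (vbasis {:V}) (vbasis {:V}) A)).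

Lemma complex_eigenvalue_basis (V : vectType rat) (A : 'End(V))
    (b : (\dim {:V}).-tuple V) :
  basis_of {:V} b ->
  complex_eigenvalue A =1 eigenvalue (map_mx ratr (mxof b b A)).
Proof.
move=> bb z; have eb := vbasisP {:V}; rewrite /complex_eigenvalue.
move: (vbasis _) eb => e eb.
suff H (b1 b2 : (\dim {:V}).-tuple V) : basis_of {:V} b1 -> basis_of {:V} b2 ->
    eigenvalue (map_mx ratr (mxof b1 b1 A)) z ->
    eigenvalue (map_mx (ratr : rat -> (Rdefinitions.R)[i]) (mxof b2 b2 A)) z.
  by apply/idP/idP; apply: H.
move=> b1b b2b /eigenvalueP[v vAz v0].
have PQ : mxof b1 b2 \1 *m mxof b2 b1 \1 = 1%:M.
  rewrite -mxof_comp //; apply/row_matrixP => i.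
  by rewrite !rowE mul_mxof comp_lfun1l id_lfunE vecofK // mulmx1.
have AP : mxof b1 b1 A *m mxof b1 b2 \1 = mxof b1 b2 \1 *m mxof b2 b2 A.
  by rewrite -!mxof_comp // comp_lfun1l comp_lfun1r.
apply/eigenvalueP; exists (v *m map_mx ratr (mxof b1 b2 \1)).
  by rewrite -mulmxA -map_mxM -AP map_mxM mulmxA vAz scalemxAl.
apply: contraNneq v0 => vP0.
by rewrite -[v]mulmx1 -(map_mx1 ratr) -PQ map_mxM mulmxA vP0 mul0mx.
Qed.

Definition hyperbolic (V : vectType rat) (A : 'End(V)) : Prop :=
  forall z, complex_eigenvalue A z -> `|z| != 1.

(* [mxof b b A] lists the coordinates of A b_i in its i-th row; its transpose is
   the usual matrix of A with respect to b. *)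
Definition anosov (n : lieAlgType rat) : Prop :=
  exists (A : 'End(n)) (b : (\dim {:n}).-tuple n),
    [/\ lie_automorphism A, basis_of {:n} b, hyperbolic A &
        exists2 M : 'M[int]_(\dim {:n}),
          M \in unitmx & (mxof b b A)^T = map_mx intr M].

(* Main.v *)
From HB Require Import structures.
Require Import Defs.
From mathcomp Require Import all_boot all_order all_algebra.
From mathcomp Require Import reals Rstruct complex ring.

(** Let K = Q(sqrt 5), with golden ratio phi.  The filiform Lie algebra over K,
    with basis X_0, ..., X_k and brackets [X_0, X_i] = X_{i+1} for 0 < i < k, is
    k-step nilpotent of dimension k + 1, so restricting scalars to Q gives
    dimension 2k + 2.  The brackets are compatible with the K-linear grading
    automorphism X_0 |-> phi X_0, X_i |-> phi^i X_i.  Multiplication by phi is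
    invertible over the integers in the Q-basis (1, phi) of K, because phi is an
    algebraic unit, so the automorphism is unimodular in the basis
    (X_i, phi X_i); its eigenvalues are positive powers of phi and of the
    conjugate 1 - phi, none of absolute value 1.

    An element is stored as the (k + 1) x 2 matrix whose i-th row holds the
    coordinates, in the basis (1, phi), of the coefficient of X_i.  Scalars of K
    act on the right through 2 x 2 matrices, and ad X_0 acts on the left through
    a shift matrix S; the two actions commute by associativity, which keeps the
    Jacobi identity ([filiform_jacobi]) and the automorphism
    ([row_power_bracket]) to a few rewrites.  The lower central series is read
    off from the powers of S ([shift_mxX], [filiform_step]).  The automorphism
    is defined over any commutative ring, which makes integrality a matter of
    base change from the integers, and hyperbolicity a matter of base change to
    the complex numbers ([filiform_anosov]). *)

Set Implicit Arguments.
Unset Strict Implicit.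
Unset Printing Implicit Defensive.

Import GRing.Theory Num.Theory passmx.

Local Open Scope ring_scope.

(** * The ring of integers of Q(sqrt 5) as matrices *)

Section GoldenMatrix.
Variable R : comNzRingType.

(** The matrix with rows (0, 1) and (1, 1): right multiplication by it sends the
    coordinates of x in the basis (1, phi) to those of x phi. *)
Definition golden_mx : 'M[R]_2 := \matrix_(i, j) ((i != 0) || (j != 0))%:R.

Lemma golden_mx_sqr : golden_mx *m golden_mx = golden_mx + 1%:M.
Proof.
apply/matrixP=> i j; rewrite !mxE !big_ord_recl big_ord0 !mxE.
by case: i => [[|[|//]] ?]; case: j => [[|[|//]] ?];
  rewrite /= ?(mulr0, mul0r, mulr1, mul1r, add0r, addr0).
Qed.

Lemma golden_mx_inv : golden_mx *m (golden_mx - 1%:M) = 1%:M.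
Proof. by rewrite mulmxBr golden_mx_sqr mulmx1 addrAC subrr add0r. Qed.

(** Multiplication by u_0 + u_1 phi, so that u *m golden_mul w represents the
    product of u and w in K. *)
Definition golden_mul (u : 'rV[R]_2) : 'M[R]_2 :=
  (u 0 0)%:M + u 0 1 *: golden_mx.

Lemma golden_mul_linear : linear golden_mul.
Proof.
move=> a u v; rewrite /golden_mul !mxE raddfD scalerDr addrACA /=.
congr (_ + _).
  by rewrite -scale_scalar_mx.
by rewrite scalerDl scalerA.
Qed.

HB.instance Definition _ := GRing.isSemilinear.Build R 'rV[R]_2 'M[R]_2 _
  golden_mul (GRing.semilinear_linear golden_mul_linear).

Lemma golden_mul_golden_mx u :
  golden_mul (u *m golden_mx) = golden_mul u *m golden_mx.
Proof.
rewrite /golden_mul mulmxDl mul_scalar_mx -scalemxAl golden_mx_sqr scalerDr.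
rewrite scalemx1 !mxE !big_ord_recl !big_ord0 !mxE /=.
rewrite !(mulr0, mulr1, add0r, addr0) scalerDl.
have -> : lift 0 0 = 1 :> 'I_2 by apply/val_inj.
by rewrite addrC addrA.
Qed.

Lemma golden_mul_commute u (W : 'M[R]_2) :
  comm_mx golden_mx W -> comm_mx (golden_mul u) W.
Proof.
move=> CW; rewrite /comm_mx /golden_mul mulmxDl mulmxDr mul_scalar_mx.
by rewrite mul_mx_scalar -scalemxAl -scalemxAr CW.
Qed.

Lemma golden_mul_commutes u w : comm_mx (golden_mul u) (golden_mul w).
Proof. by do 2!apply/golden_mul_commute/esym. Qed.

End GoldenMatrix.

Lemma map_golden_mx (R S : comNzRingType) (f : {rmorphism R -> S}) :
  map_mx f (golden_mx R) = golden_mx S.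
Proof. by apply/matrixP=> i j; rewrite !mxE rmorph_nat. Qed.

(** * Powers of the golden matrix are hyperbolic *)

Section Eigenvalues.
Variable C : numClosedFieldType.

(** A real number of absolute value 1 has square 1, while x ^+ 2 = x + 1 = 1
    would force x = 0. *)
Lemma golden_root_norm (x : C) : x \is Num.real -> x ^+ 2 = x + 1 -> `|x| != 1.
Proof.
move=> xR x2; apply/eqP=> x1; move: (real_normK xR).
rewrite x1 expr1n x2 -[LHS]add0r => /addIr x0.
by move: x1; rewrite -x0 normr0 => /eqP; rewrite eq_sym oner_eq0.
Qed.

Lemma golden_roots :
  exists a b : C, [/\ `|a| != 1, `|b| != 1, a + b = 1 & a * b = -1].
Proof.
pose s : C := sqrtC 5.
have sR : s \is Num.real by rewrite ger0_real // sqrtC_ge0 ler0n.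
have s2 : s ^+ 2 = 5 by rewrite sqrtCK.
have two0 : (2 : C) != 0 by rewrite pnatr_eq0.
pose a := (1 + s) / 2; exists a, (1 - a).
have aR : a \is Num.real by rewrite !(rpredM, rpredD, rpredV, rpred1) ?realn.
have a2 : a ^+ 2 = a + 1 by rewrite /a; field: s2.
have b2 : (1 - a) ^+ 2 = 1 - a + 1 by ring: a2.
split; [exact: golden_root_norm | | by rewrite addrC subrK |].
  by apply: golden_root_norm => //; rewrite rpredB ?rpred1.
by rewrite mulrBr mulr1 -expr2 a2 opprD addrA subrr add0r.
Qed.

Lemma golden_mxX_row_eigen (w : 'rV[C]_2) (a z : C) n :
  w != 0 -> w *m golden_mx C = a *: w -> w *m golden_mx C ^+ n = z *: w ->
  z = a ^+ n.
Proof.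
move=> w0 wa; have -> : w *m golden_mx C ^+ n = a ^+ n *: w.
  elim: n => [|n IH]; first by rewrite mulmx1 scale1r.
  by rewrite exprSr -mulmxE mulmxA IH -scalemxAl wa scalerA -exprSr.
move/esym/eqP; rewrite -subr_eq0 -scalerBl scaler_eq0 (negPf w0) orbF.
by rewrite subr_eq0 => /eqP.
Qed.

(** With a, b the two eigenvalues of the golden matrix G, (G - a)(G - b) = 0; so
    either w or w (G - a) is an eigenvector of G, still belonging to the
    eigenvalue z of the power of G, and z is a power of a or of b. *)
Lemma golden_mxX_hyperbolic (w : 'rV[C]_2) (z : C) n :
  w != 0 -> w *m golden_mx C ^+ n.+1 = z *: w -> `|z| != 1.
Proof.
have [a [b [a1 b1 abD abM]]] := golden_roots => w0 wz.
have normX (c : C) : `|c| != 1 -> `|c ^+ n.+1| != 1.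
  by rewrite normrX pexpr_eq1.
pose w' := w *m golden_mx C - a *: w.
have [wa | w'0] := eqVneq w' 0.
  have {}wa : w *m golden_mx C = a *: w.
    by apply/eqP; rewrite -subr_eq0; apply/eqP.
  by rewrite (golden_mxX_row_eigen w0 wa wz) normX.
have w'b : w' *m golden_mx C = b *: w'.
  rewrite mulmxBl -mulmxA golden_mx_sqr mulmxDr mulmx1 -scalemxAl scalerBr.
  rewrite scalerA [b * a]mulrC abM scaleN1r opprK.
  by rewrite -[b](addKr a) abD [- a + 1]addrC scalerBl scale1r addrAC.
have w'z : w' *m golden_mx C ^+ n.+1 = z *: w'.
  have CX : comm_mx (golden_mx C) (golden_mx C ^+ n.+1) by apply: commrX.
  rewrite mulmxBl -mulmxA CX mulmxA -!scalemxAl wz scalerBr !scalerA mulrC.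
  by rewrite -scalemxAl.
by rewrite (golden_mxX_row_eigen w'0 w'b w'z) normX.
Qed.

End Eigenvalues.

(** * The shift matrix *)

Section Shift.
Variables (R : comNzRingType) (k : nat).

(** On columns, e_j |-> e_{j+1} for 0 < j < k, while e_0 and e_k are sent to 0:
    the matrix of ad X_0. *)
Definition shift_mx : 'M[R]_k.+1 :=
  \matrix_(i, j) ((0 < j) && (i == j.+1 :> nat))%N%:R.

Lemma shift_mxX n :
  shift_mx ^+ n.+1 =
    \matrix_(i, j) ((0 < j) && (i == j + n.+1 :> nat))%N%:R.
Proof.
elim: n => [|n IH]; first by apply/matrixP=> i j; rewrite !mxE addn1.
apply/matrixP=> i j; rewrite exprS IH !mxE.
have [ij | ij] := boolP ((0 < j) && (i == j + n.+2 :> nat))%N.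
  have [j0 /eqP ei] := andP ij.
  have lt_jn : (j + n.+1 < k.+1)%N by rewrite -addnS -ei ltnW ?ltn_ord.
  rewrite (bigD1 (Ordinal lt_jn)) //= big1 => [|l nl]; rewrite !mxE j0 /=.
    by rewrite ei -addnS !eqxx addnS ltn0Sn mulr1 addr0.
  have [el|_] := (l : nat) =P (j + n.+1)%N; last by rewrite mulr0.
  by case/eqP: nl; apply: val_inj.
rewrite big1 // => l _; rewrite !mxE -natrM mulnb.
case: eqP => [il | _]; last by rewrite andbF.
case: eqP => [lj | _]; last by rewrite !andbF.
by move: ij; rewrite il lj -addnS eqxx andbT => /negPf->; rewrite !andbF.
Qed.

Lemma row_shift_mx0 p (v : 'M[R]_(k.+1, p)) : row 0 (shift_mx *m v) = 0.
Proof.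
apply/rowP=> c; rewrite !mxE big1 // => j _.
by rewrite mxE andbF mul0r.
Qed.

End Shift.

Lemma shift_mx_nilpotent (R : comNzRingType) k :
  shift_mx R k.+1 ^+ k.+1 = 0.
Proof.
apply/matrixP=> i j; rewrite shift_mxX !mxE.
case: eqP => [ei|]; last by rewrite andbF.
have := ltn_ord i; rewrite ei andbT; case: (nat_of_ord j) => // n.
by rewrite addSn ltnS ltnNge leq_addl.
Qed.

(** * The grading automorphism *)

Section RowPower.
Variables (R : comNzRingType) (k : nat).
Implicit Types v : 'M[R]_(k.+1, 2).

(** Row i is multiplied by a ^+ i for i > 0, and row 0 by a: the exponent
    i.-1.+1 is the maximum of i and 1. *)
Definition row_power (a : 'M[R]_2) v : 'M[R]_(k.+1, 2) :=
  \matrix_i (row i v *m a ^+ i.-1.+1).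

Lemma row_power_linear a : linear (row_power a).
Proof.
move=> c u v; apply/row_matrixP=> i.
by rewrite rowK !linearP /= !rowK mulmxDl scalemxAl.
Qed.

HB.instance Definition _ a :=
  GRing.isSemilinear.Build R 'M[R]_(k.+1, 2) 'M[R]_(k.+1, 2) _
    (row_power a) (GRing.semilinear_linear (row_power_linear a)).

Lemma row_powerK a b : a *m b = 1%:M -> cancel (row_power a) (row_power b).
Proof.
move=> ab v; apply/row_matrixP=> i; rewrite !rowK -mulmxA mulmxE.
have ba : b *m a = 1%:M by apply: mulmx1C.
by rewrite -exprMn_comm ?[a * b]ab ?expr1n ?mulmx1 //
  /GRing.comm -!mulmxE ab ba.
Qed.

Lemma row_power_mulmxr a W v : comm_mx W a ->
  row_power a (v *m W) = row_power a v *m W.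
Proof.
move=> Wa; apply/row_matrixP=> i; rewrite row_mul !rowK row_mul -!mulmxA.
by congr (_ *m _); apply: commrX.
Qed.

(** The shift raises the degree by one, except on row 0, which it kills. *)
Lemma row_power_shift_mx a v :
  row_power a (shift_mx R k *m v) = shift_mx R k *m row_power a v *m a.
Proof.
apply/row_matrixP=> i; rewrite rowK !row_mul.
rewrite ![row i _ *m _]mulmx_sum_row !mulmx_suml.
apply: eq_bigr => j _; rewrite !mxE rowK -!scalemxAl.
case: eqP => [ei|]; last by rewrite andbF !scale0r.
case: (posnP j) => [j0|j_gt0]; first by rewrite !scale0r.
by rewrite ei /= -mulmxA mulmxE -exprSr prednK.
Qed.

End RowPower.

Lemma map_row_power (R S : comNzRingType) (f : {rmorphism R -> S}) k a
    (v : 'M[R]_(k.+1, 2)) :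
  map_mx f (row_power a v) = row_power (map_mx f a) (map_mx f v).
Proof.
apply/row_matrixP=> i; rewrite -map_row !rowK map_mxM map_row.
by rewrite rmorphXn.
Qed.

Lemma row_power_golden_hyperbolic (C : numClosedFieldType) k
    (v : 'M[C]_(k.+1, 2)) z :
  v != 0 -> row_power (golden_mx C) v = z *: v -> `|z| != 1.
Proof.
move=> v0 vz; have [i vi0] : exists i, row i v != 0.
  apply/existsP; apply: contraNT v0; rewrite negb_exists => /forallP v0.
  apply/eqP/row_matrixP=> i; rewrite row0; apply/eqP.
  by move: (v0 i); rewrite negbK.
apply: (golden_mxX_hyperbolic vi0 (n := i.-1)).
rewrite -[LHS](rowK (fun i => row i v *m golden_mx C ^+ i.-1.+1)).
by rewrite -/(row_power _ _) vz linearZ.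
Qed.

(** * The Anosov property in coordinates *)

Section AnosovCriterion.
Variables (L : lieAlgType rat) (N : nat).
Variables (f : {linear 'rV[rat]_N -> L}) (g : L -> 'rV[rat]_N).
Hypotheses (fK : cancel f g) (gK : cancel g f).

Lemma dim_coordinates : \dim {:L} = N.
Proof.
have kf : lker (linfun f) == 0%VS.
  by apply/lker0P=> u v; rewrite !lfunE => /(can_inj fK).
have -> : {:L}%VS = limg (linfun f).
  by apply/vspaceP=> x; rewrite memvf -[x]gK -(lfunE f) memv_img ?memvf.
rewrite limg_dim_eq ?(eqP kf) ?capv0 //.
by rewrite dimvf; apply: mul1n.
Qed.

End AnosovCriterion.

(** The images under f of the standard row vectors form a basis, in which A has
    the integral matrix M; eigenvalues may be computed in any basis. *)
Lemma anosov_criterion (L : lieAlgType rat) N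
    (f : {linear 'rV[rat]_N -> L}) (g : L -> 'rV[rat]_N)
    (A : 'End(L)) (M : 'M[int]_N) :
    cancel f g -> cancel g f ->
    lie_automorphism A -> M \in unitmx ->
    (forall u, A (f u) = f (u *m map_mx intr M)) ->
    (forall z : (Rdefinitions.R)[i],
      eigenvalue (map_mx intr M) z -> `|z| != 1) ->
  anosov L.
Proof.
move=> fK gK; have := dim_coordinates fK gK => eN; subst N.
move=> autA unitM AM hypM.
pose b := [tuple f (delta_mx 0 i) | i < \dim {:L}].
have vecb u : vecof b u = f u.
  rewrite [u in RHS]row_sum_delta linear_sum; apply: eq_bigr => i _.
  by rewrite linearZ /= nth_mktuple.
have bb : basis_of {:L} b.
  rewrite basisEdim size_tuple leqnn andbT; apply/subvP=> x _.
  rewrite -[x]gK -vecb; apply: memv_suml => i _.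
  by apply/memvZ/memv_span/mem_nth; rewrite size_tuple.
have AbM : mxof b b A = map_mx intr M.
  apply/row_matrixP=> i; rewrite !rowE mul_mxof vecb AM -vecb.
  by rewrite vecofK // basis_free.
exists A, b; split; [exact: autA | exact: bb | |]; last first.
  exists M^T; first by rewrite unitmx_tr.
  by rewrite AbM map_trmx.
move=> z; rewrite (complex_eigenvalue_basis A bb) AbM.
rewrite (_ : map_mx ratr _ = map_mx intr M); first exact: hypM.
by apply/matrixP=> i j; rewrite !mxE ratr_int.
Qed.

(** * The filiform Lie algebra *)

Section FiliformAlgebra.
Variable k : nat.

Definition filiform : Type := 'M[rat]_(k.+1, 2).

HB.instance Definition _ := Vector.copy filiform 'M[rat]_(k.+1, 2).

(** Multiplication by the coefficient of X_0. *)
Definition coef0 (v : filiform) : 'M[rat]_2 := golden_mul (row 0 v).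

(** Since u - u_0 X_0 and v - v_0 X_0 lie in the abelian ideal spanned by
    X_1, ..., X_k, the bracket is [u, v] = ad X_0 (u_0 v - v_0 u): the
    X_0-components are killed by ad X_0. *)
Definition filiform_bracket (u v : filiform) : filiform :=
  shift_mx rat k *m (v *m coef0 u - u *m coef0 v).

Lemma coef0_shift (v : 'M[rat]_(k.+1, 2)) : coef0 (shift_mx rat k *m v) = 0.
Proof. by rewrite /coef0 row_shift_mx0 linear0. Qed.

Lemma coef0_linear : linear coef0.
Proof. by move=> a u v; rewrite /coef0 !linearP. Qed.

Lemma filiform_bracketxx u : filiform_bracket u u = 0.
Proof. by rewrite /filiform_bracket subrr mulmx0. Qed.

Lemma filiform_bracket_linear_r u : linear (filiform_bracket u).
Proof.
move=> a v w; rewrite /filiform_bracket coef0_linear mulmxDl.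
rewrite -scalemxAl [u *m _]mulmxDr -(scalemxAr a u) opprD addrACA mulmxDr.
by rewrite -scalerBr -scalemxAr.
Qed.

Lemma filiform_bracketC u v : filiform_bracket u v = - filiform_bracket v u.
Proof. by rewrite /filiform_bracket -[RHS]mulmxN opprB. Qed.

Lemma filiform_bracket_linear_l v : linear (filiform_bracket ^~ v).
Proof.
move=> a u w; rewrite /= filiform_bracketC filiform_bracket_linear_r.
by rewrite opprD -scalerN -!filiform_bracketC.
Qed.

Lemma filiform_bracket_shift u (w : 'M[rat]_(k.+1, 2)) :
  filiform_bracket u (shift_mx rat k *m w) =
    shift_mx rat k *m (shift_mx rat k *m (w *m coef0 u)).
Proof. by rewrite /filiform_bracket coef0_shift mulmx0 subr0 !mulmxA. Qed.

(** Inner brackets lie in the image of S and have no X_0-coefficient, so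
    [x, [y, z]] = S^2 (y_0 x_0 z - z_0 x_0 y); the cyclic sum cancels since
    coefficients commute. *)
Lemma filiform_jacobi x y z :
  filiform_bracket x (filiform_bracket y z)
    + filiform_bracket y (filiform_bracket z x)
    + filiform_bracket z (filiform_bracket x y) = 0.
Proof.
rewrite !filiform_bracket_shift -!mulmxDr !mulmxBl -!mulmxA.
have cC u v := golden_mul_commutes (row 0 u) (row 0 v).
rewrite [coef0 y *m coef0 x]cC [coef0 z *m coef0 x]cC [coef0 z *m coef0 y]cC.
set a := z *m _; set b := y *m _; set c := x *m _.
rewrite (_ : a - b + (c - a) + (b - c) = 0) ?mulmx0 //.
by rewrite (addrC (a - b)) subrKA subrKA subrr.
Qed.

HB.instance Definition _ := Vector_isLie.Build rat filiform
  filiform_bracket_linear_l filiform_bracket_linear_r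
  filiform_bracketxx filiform_jacobi.

End FiliformAlgebra.

(** * The lower central series *)

Lemma lie_filiformE k (u v : filiform k) :
  lie_bracket u v = shift_mx rat k *m (v *m coef0 u - u *m coef0 v).
Proof. by []. Qed.

(** After the first step v has no X_0-coefficient, and bracketing with u is
    multiplication by u_0 followed by S. *)
Lemma lower_central_shift k j (v : filiform k) :
  v \in lower_central (filiform k) j ->
  exists w : 'M[rat]_(k.+1, 2), v = shift_mx rat k ^+ j *m w.
Proof.
pose Sj j := linfun (mulmx (shift_mx rat k ^+ j) : filiform k -> filiform k).
suff /(_ j)/subvP sub :
    forall j, (lower_central (filiform k) j <= limg (Sj j))%VS.
  by move=> /sub /memv_imgP[w _ ->]; exists w; rewrite lfunE.
elim=> [|{}j IH].
  apply/subvP=> w _.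
  by rewrite -[w]mul1mx -(lfunE (mulmx 1%:M)) memv_img ?memvf.
apply/lie_spanP=> u w _ /(subvP IH) /memv_imgP[w' _ ->].
rewrite lfunE /= lie_filiformE.
suff [x ->] : exists x : filiform k,
    shift_mx rat k *m (shift_mx rat k ^+ j *m w' *m coef0 u
                       - u *m coef0 (shift_mx rat k ^+ j *m w'))
      = shift_mx rat k ^+ j.+1 *m x.
  by rewrite -(lfunE (mulmx _)) memv_img ?memvf.
case: j {IH} => [|j]; first by eexists; rewrite expr1.
exists (w' *m coef0 u).
have -> : coef0 (shift_mx rat k ^+ j.+1 *m w') = 0.
  by rewrite exprS -mulmxE -mulmxA coef0_shift.
by rewrite mulmx0 subr0 [in RHS]exprS -[in RHS]mulmxE -!mulmxA.
Qed.

(** The element is (ad X_0)^j X_1 = X_{j+1}, an iterated bracket. *)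
Lemma lower_central_shift_delta k j :
  shift_mx rat k.+1 ^+ j *m delta_mx (lift 0 0) 0
    \in lower_central (filiform k.+1) j.
Proof.
elim: j => [|j IH]; first exact: memvf.
have := memv_lie (memvf (delta_mx 0 0 : filiform k.+1)) IH.
rewrite lie_filiformE; set v := _ *m delta_mx (lift 0 0) 0.
have -> : coef0 (delta_mx 0 0 : filiform k.+1) = 1%:M.
  by rewrite /coef0 /golden_mul !mxE !eqxx /= scale0r addr0.
have v0 : row 0 v = 0.
  case: j {IH} @v => [|j] v.
    by apply/rowP=> c; rewrite /v mul1mx !mxE.
  by rewrite /v exprS -mulmxE -mulmxA row_shift_mx0.
have -> : coef0 v = 0 by rewrite /coef0 v0 linear0.
by rewrite mulmx1 mulmx0 subr0 /v mulmxA mulmxE -exprS.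
Qed.

Lemma filiform_step k : step_nilpotent (filiform k.+2) k.+2.
Proof.
split.
  apply/eqP; rewrite -subv0; apply/subvP=> v /lower_central_shift[w ->].
  by rewrite shift_mx_nilpotent mul0mx mem0v.
(* The entry in the last row and first column of S^(k+1) X_1 = X_{k+2} is 1. *)
have := lower_central_shift_delta k.+1 k.+1 => + L0; rewrite L0 memv0.
move/eqP/matrixP/(_ ord_max 0); rewrite shift_mxX !mxE.
rewrite (bigD1 (lift 0 0)) //= !mxE !eqxx mulr1 big1 => [|j nj].
  by rewrite addr0 => /eqP; rewrite oner_eq0.
by rewrite !mxE (negPf nj) mulr0.
Qed.

(** * The Anosov automorphism *)

Lemma coef0_row_power k (v : filiform k) :
  coef0 (row_power (golden_mx rat) v) = coef0 v *m golden_mx rat.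
Proof. by rewrite /coef0 rowK expr1 golden_mul_golden_mx. Qed.

Lemma row_power_bracket k (u v : filiform k) :
  row_power (golden_mx rat) (lie_bracket u v) =
  lie_bracket (row_power (golden_mx rat) u : filiform k)
    (row_power (golden_mx rat) v).
Proof.
have cC (w : filiform k) : comm_mx (coef0 w) (golden_mx rat).
  by apply: golden_mul_commute.
rewrite !lie_filiformE row_power_shift_mx linearB /= !row_power_mulmxr //.
by rewrite !coef0_row_power -mulmxA mulmxBl !mulmxA.
Qed.

Lemma filiform_anosov k : anosov (filiform k).
Proof.
pose phi := linfun (row_power (golden_mx rat) : filiform k -> filiform k).
pose M := lin_mx (@row_power int k (golden_mx int)).
have MF (F : comNzRingType) :
    map_mx intr M = lin_mx (@row_power F k (golden_mx F)).
  by apply: map_lin_mx => v; rewrite map_row_power map_golden_mx.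
have MK : M *m lin_mx (@row_power int k (golden_mx int - 1%:M)) = 1%:M.
  apply/row_matrixP=> i; rewrite !rowE mulmxA mulmx1 !mul_rV_lin /= mxvecK.
  by rewrite row_powerK ?vec_mxK // golden_mx_inv.
have [unitM _] := mulmx1_unit MK.
have autphi : lie_automorphism phi.
  split=> [|u v]; last by rewrite !lfunE /= row_power_bracket.
  exists (row_power (golden_mx rat - 1%:M)) => v; rewrite lfunE /=;
    apply: row_powerK.
    exact: golden_mx_inv.
  exact/mulmx1C/golden_mx_inv.
apply: (@anosov_criterion (filiform k) _ vec_mx mxvec phi M
          vec_mxK mxvecK autphi unitM).
  by move=> u; rewrite lfunE MF mul_rV_lin /= mxvecK.
move=> z; rewrite MF => /eigenvalueP[v vz v0].
apply: (@row_power_golden_hyperbolic _ k (vec_mx v)).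
  by rewrite vec_mx_eq0.
by rewrite -mx_rV_lin vz linearZ.
Qed.

Theorem mainTheorem3 (k : nat) (hk : (2 <= k)%N) :
  exists n : lieAlgType rat,
    step_nilpotent n k /\ anosov n /\ \dim (fullv : {vspace n}) = (2 * k + 2)%N.
Proof.
case: k hk => [|[|k]] // _; exists (filiform k.+2).
split; first exact: filiform_step.
split; first exact: filiform_anosov.
by rewrite dimvf; transitivity (k.+3 * 2)%N; rewrite // mulnC mulnS addnC.
Qed.
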